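(* Let $G=(V,E)$ be a finite, strongly connected digraph (multiple edges permitted), with a fixed cyclic permutation $t_v$ of the outgoing edges of each vertex $v$. For $n\ge1$, let $r_n$ be the number of recurrent chip-and-rotor configurations on $G$ with exactly $n$ chips. Then $$\sum_{n\ge1} r_nz^n=\det\left(\frac{D}{1-z}-A\right),$$ both as an identity in $\mathbb C$ for $|z|<1$ and as an identity in the ring of formal power series $\mathbb Z[[z]]$, where $D$ is the diagonal matrix of outdegrees and $A$ is the adjacency matrix of $G$.
   Context: A chip-and-rotor configuration is a pair $\mathbf x.\rho$ where $\mathbf x:V\to\mathbb Z$ and $\rho:V\to E$ assigns to each vertex $v$ an outgoing edge of $v$; its number of chips is $\sum_v\mathbf x(v)$. Legal move at a vertex $v$ with $\mathbf x(v)\ge1$: replace $\rho(v)$ by $\rho'(v)=t_v(\rho(v))$ and then move one chip from $v$ to the target of $\rho'(v)$ (here $t_v$ permutes the set of outgoing edges of $v$ in a single cycle). Write $\mathbf x.\rho\to\mathbf x'.\rho'$ if there is a (possibly empty) finite sequence of legal moves from $\mathbf x.\rho$ to $\mathbf x'.\rho'$. A configuration $\mathbf x.\rho$ is recurrent if (1) at least one legal move is possible from $\mathbf x.\rho$; and (2) whenever $\mathbf x'.\rho'$ and $\mathbf x''.\rho''$ are configurations with $\mathbf x.\rho\to\mathbf x''.\rho''$ and $\mathbf x'.\rho'\to\mathbf x''.\rho''$, one has $\mathbf x'.\rho'\to\mathbf x.\rho$. The adjacency matrix has entries $A(u,v)$ equal to the number of edges directed from $v$ to $u$. *)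

(* Defs.v *)
From HB Require Import structures.
From Stdlib Require Import Relation_Operators.
From mathcomp Require Import all_boot all_order all_algebra all_fingroup finmap complex.
From mathcomp Require Import boolp classical_sets functions cardinality.
From mathcomp Require Import reals topology normedtype sequences.

Set Implicit Arguments.
Unset Strict Implicit.
Unset Printing Implicit Defensive.

Import Order.TTheory GRing.Theory Num.Theory.
Import numFieldNormedType.Exports.

Local Open Scope classical_set_scope.
Local Open Scope ring_scope.

Record fps (R : Type) := FPS { coef_fps : nat -> R }.

Lemma fpsP (R : Type) (f g : fps R) :
  (forall n, coef_fps f n = coef_fps g n) -> f = g.
Proof. by case: f g => [f] [g] /= fg; congr FPS; apply: funext. Qed.

HB.instance Definition _ (R : Type) := gen_eqMixin (fps R).
HB.instance Definition _ (R : Type) := gen_choiceMixin (fps R).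

Section FpsZmodule.
Variable R : zmodType.
Implicit Types f g h : fps R.

Definition fps_zero : fps R := FPS (fun=> 0).
Definition fps_opp f : fps R := FPS (fun n => - coef_fps f n).
Definition fps_add f g : fps R := FPS (fun n => coef_fps f n + coef_fps g n).

Let fps_addA : associative fps_add.
Proof. by move=> f g h; apply: fpsP => n /=; rewrite addrA. Qed.
Let fps_addC : commutative fps_add.
Proof. by move=> f g; apply: fpsP => n /=; rewrite addrC. Qed.
Let fps_add0 : left_id fps_zero fps_add.
Proof. by move=> f; apply: fpsP => n /=; rewrite add0r. Qed.
Let fps_addN : left_inverse fps_zero fps_opp fps_add.
Proof. by move=> f; apply: fpsP => n /=; rewrite addNr. Qed.

HB.instance Definition _ :=
  GRing.isZmodule.Build (fps R) fps_addA fps_addC fps_add0 fps_addN.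

End FpsZmodule.

Section FpsRing.
Variable R : comNzRingType.
Implicit Types f g h : fps R.

Definition fps_one : fps R := FPS (fun n => (n == 0)%:R).
Definition fps_mul f g : fps R :=
  FPS (fun n => \sum_(i < n.+1) coef_fps f i * coef_fps g (n - i)%N).

Definition fps_trunc n f : {poly R} := \poly_(i < n.+1) coef_fps f i.

Lemma coef_fps_mul_trunc n k f g : (k <= n)%N ->
  coef_fps (fps_mul f g) k = (fps_trunc n f * fps_trunc n g)`_k.
Proof.
move=> kn; rewrite coefM /=; apply: eq_bigr => i _; rewrite !coef_poly !ltnS.
have le_in : (i <= n)%N by apply: leq_trans kn; rewrite -ltnS.
have le_kin : (k - i <= n)%N := leq_trans (leq_subr i k) kn.
by rewrite le_in le_kin.
Qed.

Let fps_mulC : commutative fps_mul.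
Proof.
by move=> f g; apply: fpsP => n; rewrite !(@coef_fps_mul_trunc n) // mulrC.
Qed.

Let fps_mulA : associative fps_mul.
Proof.
move=> f g h; apply: fpsP => n.
transitivity ((fps_trunc n f * (fps_trunc n g * fps_trunc n h))`_n).
  rewrite coefM /=; apply: eq_bigr => i _.
  rewrite coef_poly ltn_ord; congr (_ * _).
  exact/coef_fps_mul_trunc/leq_subr.
rewrite mulrA coefM /=; apply: esym; apply: eq_bigr => i _.
rewrite [(fps_trunc n h)`__]coef_poly ltnS leq_subr; congr (_ * _).
by apply: coef_fps_mul_trunc; rewrite -ltnS.
Qed.

Let fps_mul1 : left_id fps_one fps_mul.
Proof.
move=> f; apply: fpsP => n /=; rewrite big_ord_recl subn0 mul1r big1 ?addr0 //.
by move=> i _; rewrite mul0r.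
Qed.

Let fps_mulDl : left_distributive fps_mul (@fps_add R).
Proof.
move=> f g h; apply: fpsP => n /=; rewrite -big_split /=.
by apply: eq_bigr => i _; rewrite mulrDl.
Qed.

Let fps_one_neq0 : fps_one != 0.
Proof.
by apply/eqP => /(congr1 (fun f => coef_fps f 0)) /eqP; rewrite /= oner_eq0.
Qed.

HB.instance Definition _ := GRing.Zmodule_isComNzRing.Build (fps R)
  fps_mulA fps_mulC fps_mul1 fps_mulDl fps_one_neq0.

Definition fps_unit : {pred fps R} := fun f => `[< exists g, g * f = 1 >].
Definition fps_inv f : fps R := xget f [set g | g * f = 1].

Let fps_mulVr : {in fps_unit, left_inverse 1 fps_inv *%R}.
Proof. by move=> f /asboolP [g gf]; rewrite /fps_inv; case: xgetP => [//|/(_ g)]. Qed.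
Let fps_unitP f g : g * f = 1 -> f \in fps_unit.
Proof. by move=> gf; apply/asboolP; exists g. Qed.
Let fps_inv_out : {in [predC fps_unit], fps_inv =1 id}.
Proof.
move=> f /asboolP nf; rewrite /fps_inv; case: xgetP => [g _ gf|//].
by case: nf; exists g.
Qed.

HB.instance Definition _ := GRing.ComNzRing_hasMulInverse.Build (fps R)
  fps_mulVr fps_unitP fps_inv_out.

Definition fpsX : fps R := FPS (fun n => (n == 1)%:R).

Lemma fps_geomE : FPS (fun=> 1) * (1 - fpsX) = 1.
Proof.
rewrite mulrC; apply: fpsP => -[|n]; rewrite /= big_ord_recl /= ?subn0.
  by rewrite big_ord0 subr0 mulr1 addr0.
by rewrite big_ord_recl /= big1 => [|i _]; rewrite ?subr0 ?sub0r ?mulNr ?mul1r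
  ?mul0r ?oppr0 ?addr0 ?subrr.
Qed.

Lemma fps_unit_1subX : 1 - fpsX \is a GRing.unit.
Proof. exact: fps_unitP fps_geomE. Qed.

Lemma fps_inv_1subX : (1 - fpsX)^-1 = FPS (fun=> 1).
Proof.
by rewrite -[RHS](mulrK fps_unit_1subX) fps_geomE mul1r.
Qed.

End FpsRing.

Arguments fpsX {R}.

(* Multiple edges and loops are allowed. *)
Record digraph := Digraph {
  vertex : finType;
  edge : finType;
  source : edge -> vertex;
  target : edge -> vertex }.

Section ChipAndRotor.
Variable G : digraph.
Implicit Types (u v : vertex G) (e : edge G).

Definition out_edges v : {set edge G} := [set e | source e == v].

Definition adjacent : rel (vertex G) :=
  fun u v => [exists e, (source e == u) && (target e == v)].

(* The digraph without vertices is excluded. *)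
Definition strongly_connected : Prop :=
  (0 < #|vertex G|)%N /\ forall u v, connect adjacent u v.

(* [t v] permutes the outgoing edges of [v] in a single cycle; outside of them it
   is the identity, which is only a convention. *)
Definition rotor_mechanism (t : vertex G -> {perm edge G}) : Prop :=
  forall v, perm_on (out_edges v) (t v) /\
    {in out_edges v, forall e, porbit (t v) e = out_edges v}.

Definition rotor_config : Type :=
  {r : {ffun vertex G -> edge G} | [forall v, source (r v) == v]}.

Definition config : Type := ({ffun vertex G -> int} * rotor_config)%type.

Definition chips (c : config) v : int := c.1 v.
Definition rotor (c : config) v : edge G := val c.2 v.
Definition nchips (c : config) : int := \sum_v chips c v.

Section Moves.
Variable t : vertex G -> {perm edge G}.

Definition legal_move_at v (c c' : config) : Prop :=
  [/\ 1 <= chips c v,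
      forall u, rotor c' u = if u == v then t v (rotor c v) else rotor c u &
      forall u, chips c' u =
        chips c u - (u == v)%:R + (u == target (rotor c' v))%:R].

Definition legal_move (c c' : config) : Prop := exists v, legal_move_at v c c'.

Definition reaches : config -> config -> Prop :=
  clos_refl_trans config legal_move.

Definition recurrent (c : config) : Prop :=
  (exists c', legal_move c c') /\
  forall c' c'', reaches c c'' -> reaches c' c'' -> reaches c' c.

Definition recurrent_with (n : nat) : set config :=
  [set c | recurrent c /\ nchips c = n%:Z].

(* [fset_set A] is empty when [A] is infinite, so this is the intended number
   only once [recurrent_with n] is known to be finite. *)
Definition nb_recurrent (n : nat) : nat := #|` fset_set (recurrent_with n)|%fset.

End Moves.

Section Matrices.
Variable K : comUnitRingType.

Definition outdegree_mx : 'M[K]_#|vertex G| :=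
  diag_mx (\row_i #|out_edges (enum_val i)|%:R).

Definition adjacency_mx : 'M[K]_#|vertex G| :=
  \matrix_(i, j) #|[set e | (source e == enum_val j)
                          & (target e == enum_val i)]|%:R.

End Matrices.
End ChipAndRotor.

Arguments outdegree_mx G K : clear implicits.
Arguments adjacency_mx G K : clear implicits.

(* Main.v *)
Require Import Defs.
From Stdlib Require Import Relation_Operators Operators_Properties.
From mathcomp Require Import all_boot all_order all_algebra all_fingroup.
From mathcomp Require Import zify ring lra.

(* A configuration is recurrent iff no vertex has a negative number of chips and every
   set of vertices closed under following the rotors contains a chip. Indeed, legal moves
   preserve this property on the set of vertices that have already fired, and a closed
   sequence of legal moves fires every vertex. Conversely, let [r] be a positive vector of
   firing counts with trivial effect, obtained from the kernel of the Laplacian: as long as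
   the counts stay below [r], some vertex is still able to fire, for otherwise the vertices
   with firings left would form a set closed under the initial rotors and without chips.

   With [y = z / (1 - z)], the recurrent configurations with given rotors and with chips
   exactly on [S] contribute [y ^ #|S|] if every rotor-closed set meets [S], and nothing
   otherwise. Multilinearity in the columns expands [\det ((1 + y) D - A)] in the same way. *)

Set Implicit Arguments.
Unset Strict Implicit.
Unset Printing Implicit Defensive.

Import Order.TTheory GRing.Theory Num.Theory.

Local Open Scope ring_scope.

(** * Sets that meet every cycle of a self-map *)

Section Absorbing.
Variables (T : finType) (f : T -> T).
Implicit Types (C S : {set T}).

(** Equivalently, [S] meets every cycle of [f]: a cycle is closed under [f], and every nonempty
    closed set contains a cycle. *)
Definition absorbing S : bool :=
  [forall C : {set T}, (f @: C \subset C) && [disjoint C & S] ==> (C == set0)].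

Lemma absorbingP S :
  reflect (forall C, (forall v, v \in C -> f v \in C) ->
             (forall v, v \in C -> v \notin S) -> C = set0)
          (absorbing S).
Proof.
apply: (iffP forallP) => [abs C fC CS|abs C].
  apply/eqP/(implyP (abs C))/andP; split.
    by apply/subsetP => _ /imsetP [v vC ->]; apply: fC.
  by apply/pred0P => v /=; apply/andP => -[/CS /negP].
apply/implyP => /andP [/subsetP fC /pred0P CS]; apply/eqP/abs => v vC.
  exact/fC/imset_f.
by apply/negP => vS; have:= CS v; rewrite /= vC vS.
Qed.

Lemma absorbing_neq0 S : (0 < #|T|)%N -> absorbing S -> S != set0.
Proof.
move=> T0 /absorbingP abs; apply: contraTneq T0 => S0.
by rewrite -cardsT (abs setT) ?cards0 // => v _; rewrite S0 inE.
Qed.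

End Absorbing.

(** * Firing counts and the characterization of recurrence *)

Section Dynamics.
Variables (G : digraph) (t : vertex G -> {perm edge G}).
Implicit Types (u v w : vertex G) (e : edge G) (c : config G).
Implicit Types (q r : vertex G -> nat) (F : {set vertex G}).

Definition rotor_target (r : rotor_config G) v : vertex G := target (val r v).
Definition chip_support c : {set vertex G} := [set v | 1 <= chips c v].

Lemma source_rotor c v : source (rotor c v) = v.
Proof. by rewrite /rotor; case: c.2 => r /= /forallP /(_ v) /eqP. Qed.

Lemma mem_rotor c v : rotor c v \in out_edges v.
Proof. by rewrite inE source_rotor. Qed.

Lemma config_eq c c' : chips c =1 chips c' -> rotor c =1 rotor c' -> c = c'.
Proof.
case: c c' => [x r] [x' r'] xx rr; congr pair; first exact/ffunP.
exact/val_inj/ffunP.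
Qed.

(* [q v] legal or illegal moves at each vertex [v], in any order, lead from [c] to [c']. *)
Definition fired c q c' : Prop :=
  (forall v, rotor c' v = (t v ^+ q v)%g (rotor c v)) /\
  forall u, chips c' u = chips c u - (q u)%:Z +
    \sum_v \sum_(j < q v) (target ((t v ^+ j.+1)%g (rotor c v)) == u)%:R.

(** This is the abelian property: only the firing counts matter, not the order of the moves. *)
Lemma fired_inj c q q' c1 c2 :
  q =1 q' -> fired c q c1 -> fired c q' c2 -> c1 = c2.
Proof.
move=> qq [r1 x1] [r2 x2]; apply: config_eq => u; last by rewrite r1 r2 qq.
by rewrite x1 x2 qq; congr (_ + _); apply: eq_bigr => v _; rewrite qq.
Qed.

Lemma fired0 c : fired c (fun=> 0%N) c.
Proof.
split=> v; first by rewrite expg0 perm1.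
by rewrite subr0 big1 ?addr0 // => u _; rewrite big_ord0.
Qed.

Lemma fired_move c q c' c'' v : fired c q c' -> legal_move_at t v c' c'' ->
  fired c (fun u => q u + (u == v))%N c''.
Proof.
move=> [rq xq] [_ r' x']; split=> u.
  rewrite r'; case: eqP => [->|_]; rewrite rq; last by rewrite addn0.
  by rewrite addn1 expgSr permM.
rewrite x' xq r' eqxx rq.
have E w : \sum_(j < q w + (w == v)) (target ((t w ^+ j.+1)%g (rotor c w)) == u)%:R
  = \sum_(j < q w) (target ((t w ^+ j.+1)%g (rotor c w)) == u)%:R
    + (if w == v then
         (target ((t w ^+ (q w).+1)%g (rotor c w)) == u)%:R else 0) :> int.
  case: (w == v); last by rewrite addn0 addr0.
  by rewrite addn1 big_ord_recr.
rewrite (eq_bigr _ (fun w _ => E w)) big_split /= -big_mkcond big_pred1_eq.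
rewrite expgSr permM [_ == u]eq_sym PoszD natz; ring.
Qed.

Lemma legal_move_exists c v : (forall v, perm_on (out_edges v) (t v)) ->
  1 <= chips c v -> exists c', legal_move_at t v c c'.
Proof.
move=> pt cv.
pose r' := [ffun u => if u == v then t v (rotor c v) else rotor c u].
have r'P : [forall u, source (r' u) == u].
  apply/forallP => u; rewrite ffunE; case: (u =P v) => [->|_]; last by rewrite source_rotor.
  by have := mem_rotor c v; rewrite -(perm_closed _ (pt v)) inE.
pose x' := [ffun u => chips c u - (u == v)%:R + (u == target (r' v))%:R].
exists (x', Sub r' r'P); split=> // u; rewrite /rotor /chips /= ?ffunE //.
Qed.

Lemma reaches_fired_ind (P : (vertex G -> nat) -> config G -> Prop) c q c' c'' :
  (forall q v c1 c2, fired c q c1 -> P q c1 -> legal_move_at t v c1 c2 ->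
     P (fun u => q u + (u == v))%N c2) ->
  fired c q c' -> P q c' -> reaches t c' c'' ->
  exists q', [/\ fired c q' c'', P q' c'' & forall v, (q v <= q' v)%N].
Proof.
move=> PI cq Pq /clos_rt_rt1n_iff st.
elim: st q cq Pq => {c' c''} [c'|c1 c2 c3 [v mv] _ IH] q cq Pq.
  by exists q; split.
have [|q' [fq Pq' qq']] := IH _ (fired_move cq mv); first exact: PI mv.
by exists q'; split=> // u; apply: leq_trans (qq' u); apply: leq_addr.
Qed.

(* The condition satisfied by the vertices that have already fired. *)
Definition live_on F c : Prop :=
  (forall v, v \in F -> 0 <= chips c v) /\
  forall C : {set vertex G}, C \subset F ->
    (forall v, v \in C -> rotor_target c.2 v \in C) ->
    (forall v, v \in C -> v \notin chip_support c) -> C = set0.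

Definition live c : Prop :=
  (forall v, 0 <= chips c v) /\ absorbing (rotor_target c.2) (chip_support c).

Lemma live_onT c : live_on setT c -> live c.
Proof.
case=> c0 cC; split=> [v|]; first exact: c0.
by apply/absorbingP => C; apply/cC/subsetT.
Qed.

(** A closed set that contains [v] also contains the target of the new rotor at [v], which has just
    received a chip. Away from [v] the rotors are unchanged and no vertex loses a chip. *)
Lemma live_on_move F v c c' :
  live_on F c -> legal_move_at t v c c' -> live_on (v |: F)%SET c'.
Proof.
move=> [c0 cC] [cv rc xc]; split=> [u|C CF fC sC].
  rewrite !inE xc; have [->_ |_ /= /c0] := eqVneq u v; first lia.
  lia.
have [vC|vC] := boolP (v \in C).
  have := sC _ (fC _ vC); rewrite inE xc eqxx.
  set w := rotor_target c'.2 v.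
  have [wv|wv] := eqVneq w v; first by rewrite wv; case/negP; lia.
  have : w \in (v |: F)%SET by apply: (subsetP CF); apply: fC.
  by rewrite !inE (negPf wv) /= => /c0 w0 /negP; case; lia.
have neq u : u \in C -> u != v by apply: contraTneq => ->.
apply: cC => [|u uC|u uC].
- by apply/subsetP => u uC; have := subsetP CF _ uC; rewrite !inE (negPf (neq u uC)).
- by have := fC u uC; rewrite /rotor_target -!/(rotor _ _) rc (negPf (neq u uC)).
- by have := sC u uC; rewrite !inE xc (negPf (neq u uC)); lia.
Qed.

Hypothesis ht : rotor_mechanism t.

Let t_on v : perm_on (out_edges v) (t v). Proof. by case: (ht v). Qed.

Lemma rotor_period v e n :
  e \in out_edges v -> (t v ^+ (n * #|out_edges v|))%g e = e.
Proof.
move=> ev; have [_ /(_ e ev) Ev] := ht v.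
rewrite -Ev permX mulnC; elim: n => [|n IH]; first by rewrite muln0.
by rewrite mulnS iterD IH iter_porbit.
Qed.

Lemma sum_rotor_turn v e n (f : edge G -> int) : e \in out_edges v ->
  \sum_(j < n * #|out_edges v|) f ((t v ^+ j.+1)%g e) =
  n%:Z * \sum_(e' in out_edges v) f e'.
Proof.
move=> ev; elim: n => [|n IH]; first by rewrite big_ord0 mul0r.
rewrite mulSn addnC big_split_ord /= {}IH intS mulrDl mul1r addrC; congr (_ + _).
set e1 := t v e; have e1v : e1 \in out_edges v by rewrite perm_closed.
have [_ /(_ e1 e1v) E1] := ht v.
transitivity (\sum_(e' <- traject (t v) e1 #|out_edges v|) f e').
  rewrite (big_nth e1) size_traject big_mkord; apply: eq_bigr => j _.
  rewrite nth_traject // -addnS expgD permM rotor_period //.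
  by rewrite permX iterSr.
rewrite -E1 big_uniq ?uniq_traject_porbit //.
by apply: eq_bigl => e'; rewrite -porbit_traject.
Qed.

(** A rotor back at its start after a positive number of steps has made full turns, so it has passed
    every outgoing edge. *)
Lemma fired_loop_edge v e e0 n : (0 < n)%N -> (t v ^+ n)%g e0 = e0 ->
  e0 \in out_edges v -> e \in out_edges v ->
  exists2 j, (j < n)%N & (t v ^+ j.+1)%g e0 = e.
Proof.
move=> n0 nr rv ev; have [_ /(_ e0 rv) Er] := ht v.
have : e \in porbit (t v) e0 by rewrite Er.
case/porbitP => k ->.
have nm m : (t v ^+ (m * n))%g e0 = e0.
  by elim: m => [|m IH]; rewrite ?perm1 // mulSn expgD permM nr.
have Ek : (t v ^+ k)%g e0 = (t v ^+ (k %% n))%g e0.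
  by rewrite {1}(divn_eq k n) expgD permM nm.
(* The exponents [j.+1] start at 1, so a zero remainder corresponds to the last step [n]. *)
case: (posnP (k %% n)) => km; last first.
  exists (k %% n).-1; last by rewrite prednK.
  by rewrite -ltnS prednK // ltnW // ltnS ltn_mod.
by exists n.-1; rewrite prednK // Ek km nr perm1.
Qed.

Lemma recurrent_live c : strongly_connected G -> recurrent t c -> live c.
Proof.
move=> [_ sc] [[c1 [v mv]] rec].
(* Condition (2) of recurrence, with both configurations equal to [c1], closes the move from [c] to
   [c1] into a legal cycle. *)
have c1c : reaches t c1 c.
  by apply: (rec c1 c1); [apply: rt_step; exists v|apply: rt_refl].
pose P q c' := live_on [set u | (0 < q u)%N] c'.
have PI q u c' c'' : fired c q c' -> P q c' -> legal_move_at t u c' c'' ->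
    P (fun w => q w + (w == u))%N c''.
  move=> _ Pq /(live_on_move Pq); congr live_on; apply/setP => w.
  by rewrite !inE orbC addn_gt0 lt0b.
have P1 : P (fun w => 0 + (w == v))%N c1.
  apply: (PI _ _ c c1 (fired0 c)) => //; split=> [u|C]; first by rewrite inE.
  move=> /subsetP C0 _ _; apply/setP => u; rewrite inE.
  by apply/negP => /C0; rewrite inE.
have [q [[rq xq] Pq qv]] := reaches_fired_ind PI (fired_move (fired0 c) mv) P1 c1c.
(* The rotor of a fired vertex [u] returns to its start, so each outgoing edge of [u] is used. Its
   target [w] thus gains a chip, and only firing [w] can restore the chip count. *)
have step u w : (0 < q u)%N -> adjacent u w -> (0 < q w)%N.
  move=> qu /existsP [e /andP [/eqP eu /eqP ew]].
  have eu' : e \in out_edges u by rewrite inE eu.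
  have [j jq je] := fired_loop_edge qu (esym (rq u)) (mem_rotor c u) eu'.
  rewrite lt0n; apply/eqP => qw0; have := xq w; rewrite qw0 subr0.
  rewrite (bigD1 u) //= (bigD1 (Ordinal jq)) //= je ew eqxx.
  have : 0 <= \sum_(i < q u | i != Ordinal jq)
      (target ((t u ^+ i.+1)%g (rotor c u)) == w)%:R :> int by apply: sumr_ge0.
  have : 0 <= \sum_(i | i != u) \sum_(j < q i)
      (target ((t i ^+ j.+1)%g (rotor c i)) == w)%:R :> int.
    by apply: sumr_ge0 => i _; apply: sumr_ge0.
  by rewrite mulr1n; move: (\sum_(i < q u | _) _) (\sum_(i | _) _) (chips c w) => a b x; lia.
apply: live_onT; move: Pq; rewrite /P; congr live_on; apply/setP => u.
rewrite !inE; case/connectP: (sc v u) => p.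
have : (0 < q v)%N by have := qv v; rewrite eqxx.
elim: p v {mv qv P1} => [|w p IH] v qv /=; first by move=> _ ->.
by case/andP => vw; apply: IH; apply: step vw.
Qed.

Definition firing_period r : Prop :=
  (forall v, (0 < r v)%N) /\ forall c, fired c r c.

Lemma live_reaches_back r c q c' : (forall c, fired c r c) -> live c ->
  fired c q c' -> (forall v, q v <= r v)%N -> (forall v, 0 <= chips c' v) ->
  reaches t c' c.
Proof.
move=> fr [c0 /absorbingP cC].
have [n] := ubnP (\sum_v (r v - q v))%N.
elim: n q c' => // n IH q c' le_n fq qr c'0.
have [/existsP [v /andP [qv cv]]|] :=
    boolP [exists v, (q v < r v)%N && (1 <= chips c' v)].
  have [c1 mv] := legal_move_exists t_on cv.
  apply: rt_trans (rt_step _ _ _ _ (ex_intro _ v mv)) _.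
  apply: IH (fired_move fq mv) _ _.
  - move: le_n; rewrite ltnS; apply: leq_trans.
    rewrite [ltnLHS](bigD1 v) //= [leqRHS](bigD1 v) //= eqxx.
    rewrite -addSn leq_add //; first lia.
    by apply: leq_sum => u /negPf ->; rewrite addn0.
  - by move=> u; have := qr u; have [->|] := eqVneq u v; lia.
  - by case: mv => _ _ xc u; rewrite xc; have := c'0 u; have [->|] := eqVneq u v; lia.
(* No move is possible within the remaining counts. The set [C] of vertices with firings left is
   shown to be closed under the rotors of [c] and without chips in [c], hence empty. *)
rewrite negb_exists => /forallP stuck.
pose C : {set vertex G} := [set v | (q v < r v)%N].
suff C0 : C = set0.
  have Eq : q =1 r.
    move=> v; apply/eqP; rewrite eqn_leq qr leqNgt.
    by have := in_set0 v; rewrite -C0 inE => ->.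
  by rewrite (fired_inj Eq fq (fr c)); apply: rt_refl.
have c'C v : v \in C -> chips c' v = 0.
  by rewrite inE => vC; have := stuck v; rewrite vC /=; have := c'0 v; lia.
pose hit v (j : nat) := target ((t v ^+ j.+1)%g (rotor c v)) \in C.
(* [a v] counts the remaining firings at [v] whose chip would leave [C]. *)
pose a v : int := \sum_(q v <= j < r v) (~~ hit v j)%:R.
have a0 v : 0 <= a v by apply: sumr_ge0.
(* No chip sits on [C] and every firing left to do is in [C], so no chip may leave [C]. *)
have balance : \sum_(v in C) (chips c v + a v) = 0.
  have tot r' c'' : fired c r' c'' -> \sum_(u in C) chips c'' u =
      \sum_(u in C) chips c u - \sum_(u in C) (r' u)%:Z +
      \sum_v \sum_(0 <= j < r' v) (hit v j)%:R.
    move=> [_ xr']; rewrite (eq_bigr _ (fun u _ => xr' u)) big_split sumrB /=.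
    congr (_ + _); rewrite exchange_big /=; apply: eq_bigr => v _.
    rewrite exchange_big /= big_mkord; apply: eq_bigr => j _.
    rewrite /hit; set w := target _; rewrite -natr_sum; congr _%:R.
    have [wC|wC] := boolP (w \in C).
      by rewrite (bigD1 w) //= eqxx big1 // => u /andP [_ /negPf]; rewrite eq_sym => ->.
    by rewrite big1 // => u uC; case: eqP => // wu; rewrite wu uC in wC.
  have split_hit v : \sum_(0 <= j < r v) (hit v j)%:R =
      \sum_(0 <= j < q v) (hit v j)%:R + ((r v)%:Z - (q v)%:Z - a v).
    rewrite (@big_cat_nat _ _ _ (q v)) //=; congr (_ + _).
    have -> : (r v)%:Z - (q v)%:Z = \sum_(q v <= j < r v) 1.
      by rewrite big_const_nat iter_addr_0 natz -subzn.
    by rewrite -sumrB; apply: eq_bigr => j _; case: (hit v j).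
  have := tot _ _ fq; have := tot _ _ (fr c).
  rewrite (eq_bigr _ (fun v _ => split_hit v)) [\sum_v (_ + _)]big_split /=.
  rewrite [\sum_v (_ - a v)](bigID (mem C)) /=.
  rewrite [\sum_(v | v \notin C) (_ - a v)]big1; last first.
    move=> v; rewrite inE -leqNgt => rq.
    by rewrite /a (_ : q v = r v) ?big_geq ?subrr //; apply/eqP; rewrite eqn_leq qr.
  rewrite (eq_bigr _ c'C) !sumrB big1_eq big_split /=.
  move: (\sum_(_ in C) chips _ _) (\sum_(_ in C) (r _)%:Z) (\sum_(_ in C) (q _)%:Z).
  move: (\sum_(_ in C) a _) (\sum_v \sum_(_ <= _ < _) _) => ? ? ? ? ?; lia.
have all0 v : v \in C -> chips c v + a v = 0.
  by move: v; apply: psumr_eq0P balance => v _; rewrite addr_ge0.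
(* The last remaining firing at [v] follows the rotor of [c] at [v], since the counts [r] restore
   all rotors; it stays in [C] because [a v] vanishes. *)
apply: cC => v vC.
  have av0 : a v = 0 by have := all0 v vC; have := a0 v; have := c0 v; lia.
  have qv : (q v <= (r v).-1 < r v)%N by move: vC; rewrite inE; lia.
  have : hit v (r v).-1.
    have /eqP := av0; rewrite psumr_eq0 // => /allP /(_ (r v).-1).
    by rewrite mem_index_iota qv => /(_ isT); case: (hit v _).
  rewrite /hit prednK; last by lia.
  by case: (fr c) => /(_ v) <-.
by rewrite inE; have := all0 v vC; have := a0 v; have := c0 v; lia.
Qed.

Lemma live_move v c c' : live c -> legal_move_at t v c c' -> live c'.
Proof.
move=> [c0 /absorbingP cC] mv; apply: live_onT.
rewrite -(setUT [set v]); apply: live_on_move mv; split=> // C _; exact: cC.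
Qed.

Lemma live_recurrent r c : firing_period r -> (0 < #|vertex G|)%N ->
  live c -> recurrent t c.
Proof.
move=> [r0 fr] G0 lc; split.
  have /set0Pn [v] := absorbing_neq0 G0 lc.2; rewrite inE => cv.
  by have [c' mv] := legal_move_exists t_on cv; exists c', v.
move=> c' c'' cc'' c'c''; apply: rt_trans c'c'' _.
move/clos_rt_rt1n_iff: cc'' => cc''.
(* The moves from [c] to [c''] are undone one at a time: a single firing is below [r], and liveness
   persists along the way. *)
elim: cc'' lc => {c c' c''} [c1 _|c1 c2 c3 [v mv] _ IH lc].
  exact: rt_refl.
have lc2 := live_move lc mv.
apply: rt_trans (IH lc2) _.
apply: (live_reaches_back fr lc (fired_move (fired0 c1) mv)) lc2.1.
by move=> u; apply: leq_trans (r0 u); case: (u == v).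
Qed.

End Dynamics.

(** * A positive vector of firing counts with trivial effect *)

Section Period.
Variable G : digraph.
Implicit Types (u v : vertex G) (e : edge G).

(* The Laplacian is singular; by the triangle inequality the absolute value of a
   vector in its kernel is again in the kernel. *)
Lemma balanced_weight : strongly_connected G ->
  exists p : vertex G -> nat, (forall v, 0 < p v)%N /\
    forall u, \sum_(e | target e == u) (p (source e))%:Z =
              \sum_(e | source e == u) (p u)%:Z.
Proof.
case=> G0 sc.
pose M : 'M[int]_#|vertex G| := \matrix_(i, j) \sum_(e | source e == enum_val i)
  ((source e == enum_val j)%:R - (target e == enum_val j)%:R).
have sum1 v : \sum_(j < #|vertex G|) (v == enum_val j)%:R = 1 :> int.
  rewrite (bigD1 (enum_rank v)) //= enum_rankK eqxx big1 ?addr0 // => j.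
  by case: (v =P _) => // ->; rewrite enum_valK eqxx.
(* The rows of [M] sum to zero, so some nonzero [w0] lies in the left kernel; this is a signed
   weight with equal inflow and outflow at each vertex. *)
have : \det M == 0.
  rewrite -det_tr; apply/det0P; exists (const_mx 1).
    by apply/eqP => /rowP /(_ (enum_rank (enum_val (Ordinal G0)))); rewrite !mxE.
  apply/rowP => i; rewrite !mxE; under eq_bigr do rewrite !mxE mul1r.
  rewrite exchange_big big1 // => e _ /=.
  by rewrite sumrB !sum1 subrr.
case/det0P => w0 w0n w0M.
pose w v := w0 0 (enum_rank v).
have wE u : \sum_(e | target e == u) w (source e) = \sum_(e | source e == u) w u.
  have := congr1 (fun B : 'rV_ _ => B 0 (enum_rank u)) w0M.
  rewrite !mxE; under eq_bigr do rewrite !mxE enum_rankK.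
  have -> : \sum_j w0 0 j * (\sum_(e | source e == enum_val j)
      ((source e == u)%:R - (target e == u)%:R)) =
      \sum_e w (source e) * ((source e == u)%:R - (target e == u)%:R).
    rewrite (partition_big (fun e => enum_rank (source e)) xpredT) //=.
    apply: eq_bigr => j _; rewrite mulr_sumr; apply: eq_big => e.
      by rewrite -(can_eq enum_valK) enum_rankK.
    by move/eqP=> ej; rewrite /w ej enum_valK.
  under eq_bigr do rewrite mulrBr; rewrite sumrB.
  move/eqP; rewrite subr_eq0 => /eqP E; apply: esym.
  transitivity (\sum_(e | source e == u) w (source e)).
    by apply: eq_bigr => e /eqP ->.
  rewrite [LHS]big_mkcond [RHS]big_mkcond /=.
  transitivity (\sum_e w (source e) * (source e == u)%:R).
    by apply: eq_bigr => e _; case: eqP; rewrite ?mulr1 ?mulr0.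
  by rewrite E; apply: eq_bigr => e _; case: eqP; rewrite ?mulr1 ?mulr0.
pose p v := `|w v|%N.
have pE u : \sum_(e | target e == u) (p (source e))%:Z =
            \sum_(e | source e == u) (p u)%:Z.
  have le_p v : 0 <= \sum_(e | target e == v) (p (source e))%:Z -
                     \sum_(e | source e == v) (p v)%:Z.
    rewrite subr_ge0; have -> : \sum_(e | source e == v) (p v)%:Z =
        `|\sum_(e | source e == v) w v|.
      by rewrite !sumr_const normrMn abszE.
    rewrite -wE; under [leRHS]eq_bigr do rewrite abszE.
    exact: ler_norm_sum.
  (* The inflow is at least the outflow at every vertex, and both have the same total over all
     edges; so equality holds everywhere. *)
  apply/eqP; rewrite -subr_eq0; apply/eqP; move: u (erefl true).
  apply: psumr_eq0P => [v _|]; first exact: le_p.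
  rewrite sumrB; apply/eqP; rewrite subr_eq0; apply/eqP.
  transitivity (\sum_e (p (source e))%:Z).
    by rewrite [RHS](partition_big (@target G) xpredT).
  rewrite (partition_big (@source G) xpredT) //=; apply: eq_bigr => v _.
  by apply: eq_bigr => e /eqP ->.
exists p; split => // u.
have [v pv] : exists v, (0 < p v)%N.
  case/rV0Pn: w0n => i wi; exists (enum_val i); rewrite lt0n absz_eq0 /w.
  by rewrite enum_valK.
case/connectP: (sc v u) => s; elim: s v pv => [|x s IH] v pv /=; first by move=> _ ->.
case/andP => /existsP [e /andP [/eqP ev /eqP ex]]; apply: IH.
(* Weight zero at [x] would make the inflow of [x] zero, contradicting the positive weight of its
   predecessor [v]. *)
rewrite lt0n; apply/eqP => px.
have := pE x; rewrite [RHS]big1 => [/eqP|e' _]; last by rewrite px.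
rewrite psumr_eq0 // => /allP /(_ e (mem_index_enum _)).
by rewrite ex eqxx ev eqz_nat; move: pv; case: (p v).
Qed.

(** Firing each [v] for [p v] full turns restores its rotor and sends [p v] chips along each
    outgoing edge, so the balance of [p] restores the chips. *)
Lemma exists_firing_period (t : vertex G -> {perm edge G}) (c : config G) :
  strongly_connected G -> rotor_mechanism t -> exists r, firing_period t r.
Proof.
move=> hG ht; have [p [p0 pE]] := balanced_weight hG.
exists (fun v => p v * #|out_edges v|)%N; split=> [v|c'].
  by rewrite muln_gt0 p0; apply/card_gt0P; exists (rotor c v); apply: mem_rotor.
split=> u; first by rewrite rotor_period // mem_rotor.
under eq_bigr do
  rewrite (sum_rotor_turn ht _ (fun e => (target e == u)%:R)) ?mem_rotor //.
rewrite -[LHS]addr0 -addrA; congr (_ + _); apply/esym/eqP.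
rewrite addrC subr_eq0; apply/eqP; transitivity (\sum_(e | source e == u) (p u)%:Z).
  rewrite -pE [RHS]big_mkcond [RHS](partition_big (@source G) xpredT) //=.
  apply: eq_bigr => v _; rewrite mulr_sumr; apply: eq_big => e.
    by rewrite inE.
  by rewrite inE => /eqP ->; case: eqP; rewrite ?mulr1 ?mulr0.
rewrite sumr_const -mulr_natr PoszM natz; congr (_ * _%:Z).
by apply: eq_card => e; rewrite inE.
Qed.
End Period.

(** * Expansion of the determinant over rotors and supports *)

Section Determinant.
Variable K : comNzRingType.

(** Multilinearity in all rows at once, by distributing the product in each Leibniz term. *)
Lemma det_sum_rows n (J : finType) (P : 'I_n -> pred J)
    (B : 'I_n -> J -> 'I_n -> K) :
  \det (\matrix_(i, k) \sum_(j | P i j) B i j k) =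
  \sum_(g in family P) \det (\matrix_(i, k) B i (g i) k).
Proof.
rewrite exchange_big /=; apply: eq_bigr => s _.
under eq_bigr do rewrite mxE.
rewrite bigA_distr_big_dep mulr_sumr; apply: eq_bigr => g _; congr (_ * _).
by apply: eq_bigr => i _; rewrite mxE.
Qed.

(* If [S] is absorbing, then only the identity contributes to the Leibniz formula, since
   the points moved by a contributing permutation form an [f]-closed set disjoint from [S];
   otherwise the largest such set gives a vector in the kernel. *)
Lemma det_absorbing (T : finType) (f : T -> T) (S : {set T}) (y : K) :
  \det (\matrix_(i < #|T|, j < #|T|)
     if enum_val i \in S then y * (i == j)%:R
     else (i == j)%:R - (f (enum_val i) == enum_val j)%:R) =
  if absorbing f S then y ^+ #|S| else 0.
Proof.
set M := (X in \det X).
have [/absorbingP abs|nabs] := boolP (absorbing f S).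
  rewrite /determinant (bigD1 1%g) //= [X in _ + X]big1 => [|s s1].
    rewrite odd_perm1 mul1r addr0 -prodr_const [RHS]big_mkcond /=.
    rewrite (reindex (@enum_val T T)) /=; last exact/onW_bij/enum_val_bij.
    apply: eq_bigr => i _; rewrite mxE perm1 eqxx mulr1.
    case: ifP => // iS; case: eqP => [fi|_]; last by rewrite subr0.
    (* A fixed point of [f] outside [S] would form a closed set by itself. *)
    suff : [set enum_val i] = set0 :> {set T}.
      by move/setP/(_ (enum_val i)); rewrite !inE eqxx.
    by apply: abs => v; rewrite inE => /eqP ->; rewrite ?fi ?inE ?iS.
  have [/existsP [i /andP [si Mi]]|] := boolP [exists i, (s i != i) &&
      ((enum_val i \in S) || (f (enum_val i) != enum_val (s i)))].
    rewrite (bigD1 i) //= mxE [i == _]eq_sym (negPf si).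
    case: ifP Mi => [_ _|_ /= /negPf ->]; first by rewrite mulr0 mul0r mulr0.
    by rewrite subrr mul0r mulr0.
  rewrite negb_exists => /forallP sf; case/eqP: s1; apply/permP => i.
  have sfE j : s j != j -> enum_val j \notin S /\ f (enum_val j) = enum_val (s j).
    by move=> sj; have := sf j; rewrite sj /= negb_or => /andP [-> /negPn /eqP].
  have/setP/(_ (enum_val i)) : [set v | s (enum_rank v) != enum_rank v] = set0.
    apply: abs => v; rewrite !inE => sv; have := sfE _ sv; rewrite enum_rankK => -[// _ ->].
    by rewrite enum_valK (inj_eq perm_inj).
  by rewrite !inE enum_valK perm1 => /negPn /eqP.
pose closed (C : {set T}) := [forall v in C, (f v \in C) && (v \notin S)].
have closedP (C : {set T}) : reflect (forall v, v \in C -> f v \in C /\ v \notin S) (closed C).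
  by apply: (iffP forall_inP) => cC v /cC /andP.
pose C0 := \bigcup_(C : {set T} | closed C) C.
have mem_C0 (C : {set T}) v : closed C -> v \in C -> v \in C0.
  by move=> cC vC; apply/bigcupP; exists C.
have C0P v : v \in C0 -> f v \in C0 /\ v \notin S.
  case/bigcupP => C cC /(closedP _ cC) [fC vS].
  by split=> //; apply: mem_C0 cC fC.
pose w : 'cV[K]_#|T| := \col_i (enum_val i \in C0)%:R.
have Mw : M *m w = 0.
  apply/colP => i; rewrite !mxE; under eq_bigr do rewrite !mxE.
  set v := enum_val i.
  have sumE u : \sum_(j < #|T|) (u == enum_val j)%:R * (enum_val j \in C0)%:R
      = (u \in C0)%:R :> K.
    rewrite (bigD1 (enum_rank u)) //= enum_rankK eqxx mul1r big1 ?addr0 // => j.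
    by case: (u =P _) => [->|]; rewrite ?mul0r // enum_valK eqxx.
  have vE (j : 'I_#|T|) : (i == j) = (v == enum_val j) by rewrite (inj_eq enum_val_inj).
  have [vS|vS] := boolP (v \in S).
    under eq_bigr do rewrite vE -mulrA; rewrite -mulr_sumr sumE.
    by case: (boolP (v \in C0)) => [/C0P []|]; rewrite ?vS ?mulr0.
  under eq_bigr do rewrite vE mulrBl; rewrite sumrB !sumE.
  have [vC0|vC0] := boolP (v \in C0).
    by have [-> _] := C0P _ vC0; rewrite subrr.
  case: (boolP (f v \in C0)) => [/bigcupP [C cC fvC]|_]; last by rewrite subrr.
  case/negP: vC0; apply: (mem_C0 (v |: C)); rewrite ?inE ?eqxx //.
  apply/closedP => u; rewrite !inE => /orP [/eqP ->|uC]; first by rewrite fvC orbT.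
  by have [-> ->] := closedP _ cC _ uC; rewrite orbT.
have /existsP [v vC0] : [exists v, v \in C0].
  apply: contraNT nabs; rewrite negb_exists => /forallP C00.
  apply/absorbingP => C fC CS; apply/setP => v; rewrite inE; apply/negP => vC.
  case/negP: (C00 v); apply: mem_C0 vC; apply/closedP => u uC.
  by split; [exact: fC|exact: CS].
(* Over a ring a nonzero kernel vector is not enough; but the adjugate gives [\det M] times [w]
   equal to zero, and [w] has an entry 1. *)
have := congr1 (fun B : 'cV_ _ => B (enum_rank v) 0) (mulmxA (\adj M) M w).
by rewrite Mw mulmx0 mul_adj_mx mul_scalar_mx !mxE enum_rankK vC0 mulr1.
Qed.
End Determinant.

(* Column [v] of the matrix is the sum, over the edges [e] leaving [v], of [y] times the basis
   vector [v] and of the difference of the basis vectors [v] and [target e]; multilinearity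
   thus selects a rotor and a set of vertices. *)
Lemma det_outdegree_adjacency (K : comUnitRingType) (G : digraph) (y : K) :
  \det ((1 + y) *: outdegree_mx G K - adjacency_mx G K) =
  \sum_(p : rotor_config G * {set vertex G} | absorbing (rotor_target p.1) p.2)
     y ^+ #|p.2|.
Proof.
pose B (i : 'I_#|vertex G|) (x : edge G * bool) (j : 'I_#|vertex G|) : K :=
  if x.2 then y * (i == j)%:R else (i == j)%:R - (target x.1 == enum_val j)%:R.
pose P (i : 'I_#|vertex G|) : pred (edge G * bool) :=
  fun x => source x.1 == enum_val i.
pose h (p : rotor_config G * {set vertex G}) : {ffun 'I_#|vertex G| -> edge G * bool} :=
  [ffun i => (val p.1 (enum_val i), enum_val i \in p.2)].
rewrite -det_tr (_ : _^T = \matrix_(i, j) \sum_(x | P i x) B i x j); last first.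
  apply/matrixP => i j; rewrite !mxE eq_sym.
  have -> : \sum_(x | P i x) B i x j =
      \sum_(e | source e == enum_val i) \sum_b B i (e, b) j.
    by rewrite pair_big_dep; apply: eq_big => [[e b]|[e b] _] //=; rewrite andbT.
  under [RHS]eq_bigr do rewrite big_bool /B /= addrA.
  rewrite sumrB sumr_const; congr (_ - _).
    have [<-|_] := eqVneq i j; last by rewrite !mulr0n !mulr0 addr0 mul0rn.
    rewrite !mulr1n mulr1 [y + 1]addrC mulr_natr; congr (_ *+ _).
    by apply: eq_card => e; rewrite !inE.
  rewrite -sum1_card natr_sum big_mkcond [RHS]big_mkcond; apply: eq_bigr => e _.
  by rewrite inE; case: (_ == enum_val i); case: (_ == enum_val j).
rewrite det_sum_rows big_mkcond [RHS]big_mkcond /=.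
(* Choosing an edge and a boolean in each row amounts to choosing a rotor configuration and a set of
   vertices, through [h]. *)
have -> : \sum_g (if g \in family P then \det (\matrix_(i, k) B i (g i) k) else 0) =
    \sum_(g in h @: setT) \det (\matrix_(i, k) B i (g i) k).
  rewrite -big_mkcond; apply: eq_bigl => g; apply/familyP/imsetP => [gP|[p _ ->] i].
    pose r : {ffun vertex G -> edge G} := [ffun v => (g (enum_rank v)).1].
    have rP : [forall v, source (r v) == v].
      apply/forallP => v; rewrite ffunE; have := gP (enum_rank v).
      by rewrite /P /in_mem /= enum_rankK.
    exists (Sub r rP, [set v | (g (enum_rank v)).2]) => //.
    by apply/ffunP => i; rewrite !ffunE inE enum_valK; case: (g i).
  by rewrite ffunE /P /in_mem /=; case: p.1 => r /= /forallP.
rewrite big_imset /= => [|p p' _ _ /ffunP hE]; last first.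
  case: p p' hE => [r S] [r' S'] /= hE; congr pair.
    apply/val_inj/ffunP => v; have := hE (enum_rank v).
    by rewrite !ffunE enum_rankK => -[].
  by apply/setP => v; have := hE (enum_rank v); rewrite !ffunE enum_rankK => -[].
rewrite (eq_bigl xpredT) => [|p]; last by rewrite inE.
apply: eq_bigr => p _; rewrite -(det_absorbing (rotor_target p.1)).
by congr (\det _); apply/matrixP => i j; rewrite !mxE ffunE.
Qed.

(** * Powers of the series of positive chip numbers *)

Section PositivePart.
Variable K : comNzRingType.

(* The series of [z / (1 - z)]. *)
Definition fps_pos : fps K := FPS (fun n => (n != 0%N)%:R).

Lemma fps_1D_pos : 1 + fps_pos = FPS (fun=> 1).
Proof. by apply: fpsP => -[|n]; rewrite /= ?addr0 ?add0r. Qed.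

Lemma coef_fps_sum (I : finType) (P : pred I) (F : I -> fps K) n :
  coef_fps (\sum_(i | P i) F i) n = \sum_(i | P i) coef_fps (F i) n.
Proof. by elim/big_rec2: _ => //= i x y _ <-. Qed.

Lemma coef_fps_prod_trunc (I : finType) (F : I -> fps K) n k : (k <= n)%N ->
  coef_fps (\prod_i F i) k = (\prod_i fps_trunc n (F i))`_k.
Proof.
move: k; elim/big_rec2: _ => [k _|i p f _ IH k kn]; first by rewrite coef1.
rewrite coefM /=; apply: eq_bigr => j _.
have jk : (j <= k)%N by rewrite -ltnS.
rewrite coef_poly ltnS (leq_trans jk kn) IH //.
exact: leq_trans (leq_subr _ _) kn.
Qed.

(** In the expanded product each vertex of [S] takes a positive exponent and every other vertex
    takes 0. Truncation at [n] loses nothing, as the exponents sum to [n]. *)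
Lemma coef_fps_posX (T : finType) (S : {set T}) n :
  coef_fps (fps_pos ^+ #|S|) n =
  #|[set x : {ffun T -> 'I_n.+1} | (\sum_v (x v : nat) == n)%N &
      [set v | x v != 0%N :> nat] == S]|%:R.
Proof.
have -> : fps_pos ^+ #|S| = \prod_v (if v \in S then fps_pos else 1).
  by rewrite -big_mkcond prodr_const.
rewrite (@coef_fps_prod_trunc _ _ n) //.
have truncE v : fps_trunc n (if v \in S then fps_pos else 1) =
    \sum_(i < n.+1) ((v \in S) == (i != 0%N :> nat))%:R *: 'X^i.
  rewrite /fps_trunc poly_def; apply: eq_bigr => i _; congr (_ *: _).
  by case: (v \in S) => //=; case: (i : nat).
under eq_bigr do rewrite truncE.
rewrite bigA_distr_bigA /= coef_sum -sum1_card natr_sum [RHS]big_mkcond /=.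
apply: eq_bigr => x _; rewrite inE scaler_prod prodrXr coefZ coefXn eq_sym.
have -> : \prod_v ((v \in S) == (x v != 0%N :> nat))%:R =
    ([set v | x v != 0%N :> nat] == S)%:R :> K.
  have [<-|] := eqVneq; first by rewrite big1 // => v _; rewrite inE eqxx.
  have [/forallP SE|/forallPn [v vS] _] :=
      boolP [forall v, (v \in S) == (x v != 0%N :> nat)].
    by case/eqP; apply/setP => v; rewrite inE -(eqP (SE v)).
  by rewrite (bigD1 v) //= (negPf vS) mul0r.
by case: (_ == n); case: (_ == S); rewrite ?mulr1 ?mulr0.
Qed.

(** With [P] the series [fps_pos], this is the identity [(1 - X) P ^ (k+1) = X P ^ k] in degree
    [n+1]. *)
Lemma coef_fps_posX_rec k n :
  coef_fps (fps_pos ^+ k.+1) n.+1 =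
  coef_fps (fps_pos ^+ k.+1) n + coef_fps (fps_pos ^+ k) n.
Proof.
rewrite exprSr /= [LHS]big_ord_recr /= subnn mulr0 addr0 [LHS]big_ord_recr /=.
rewrite subSnn mulr1 [in RHS]big_ord_recr /= subnn mulr0 addr0; congr (_ + _).
apply: eq_bigr => i _; have /= lt_in := ltn_ord i.
by rewrite !subn_eq0 -!ltnNge ltnS (ltnW lt_in) lt_in.
Qed.

Lemma coef_fps_posX0 k : coef_fps (fps_pos ^+ k.+1) 0 = 0.
Proof. by rewrite exprSr /= big_ord_recl big_ord0 mulr0 addr0. Qed.

End PositivePart.

(** * Counting live configurations by rotors and support *)

Section Counting.
Variables (G : digraph).

(** Bounding each chip number by the total [n] places the live configurations in a finite type. *)
Definition live_configs n : {set {ffun vertex G -> 'I_n.+1} * rotor_config G} :=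
  [set p : {ffun vertex G -> 'I_n.+1} * rotor_config G |
    (\sum_v (p.1 v : nat) == n)%N &
    absorbing (rotor_target p.2) [set v | p.1 v != 0%N :> nat]].

Lemma card_live_configs (K : comNzRingType) n :
  #|live_configs n|%:R =
  \sum_(p : rotor_config G * {set vertex G} | absorbing (rotor_target p.1) p.2)
     coef_fps (fps_pos K ^+ #|p.2|) n.
Proof.
under eq_bigr do rewrite coef_fps_posX.
rewrite -natr_sum; congr _%:R.
pose supp (x : {ffun vertex G -> 'I_n.+1}) : {set vertex G} :=
  [set v | x v != 0%N :> nat].
rewrite -sum1_card (partition_big (fun p => (p.2, supp p.1))
    (fun p => absorbing (rotor_target p.1) p.2)) /= => [|p]; last by rewrite inE => /andP [].
apply: eq_bigr => -[r S] /= abs; rewrite sum1_card.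
have pair_inj : injective (fun x : {ffun vertex G -> 'I_n.+1} => (x, r)) by move=> x x' [].
rewrite -(card_imset _ pair_inj); apply: eq_card => -[x r'].
rewrite -topredE /= inE xpair_eqE /=; apply/andP/imsetP.
  case=> /andP [xn _] /andP [/eqP -> xS]; exists x => //.
  by rewrite inE xn.
by case=> x' + [-> ->]; rewrite inE => /andP [-> /eqP xS]; rewrite /supp xS abs !eqxx.
Qed.
End Counting.

(* Only imported here, since classical sets shadow the notations for finite sets. *)
From mathcomp Require Import complex finmap.
From mathcomp Require Import boolp classical_sets functions cardinality.
From mathcomp Require Import reals topology normedtype sequences.

Import numFieldNormedType.Exports.

Local Open Scope classical_set_scope.

(** * Finiteness and the identity of formal power series *)

Section CountRecurrent.
Variables (G : digraph) (t : vertex G -> {perm edge G}).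
Hypotheses (hG : strongly_connected G) (ht : rotor_mechanism t).

Let config_of n (p : {ffun vertex G -> 'I_n.+1} * rotor_config G) : config G :=
  ([ffun v => (p.1 v : nat)%:Z], p.2).

Let config_of_inj n : injective (@config_of n).
Proof.
move=> [x r] [x' r'] [/ffunP xx ->]; congr pair; apply/ffunP => v.
by apply: val_inj; have := xx v; rewrite !ffunE => -[].
Qed.

Lemma recurrent_withE n :
  recurrent_with t n = [set` [fset config_of p | p in live_configs G n]%fset].
Proof.
apply/seteqP; split=> c /=.
  case=> rc nc; have [c0 cC] := recurrent_live ht hG rc.
  have cn v : (`|chips c v| < n.+1)%N.
    rewrite ltnS -lez_nat gez0_abs // -nc /nchips (bigD1 v) //= lerDl.
    exact: sumr_ge0.
  pose x : {ffun vertex G -> 'I_n.+1} := [ffun v => Ordinal (cn v)].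
  apply/imfsetP; exists (x, c.2) => /=; last first.
    rewrite [LHS]surjective_pairing; congr pair; apply/ffunP => v.
    by rewrite !ffunE /= gez0_abs.
  rewrite inE; apply/andP; split.
    rewrite -eqz_nat -nc /nchips -natz natr_sum; apply/eqP/eq_bigr => v _.
    by rewrite ffunE natz /= gez0_abs.
  congr (absorbing _ _): cC; apply/setP => v; rewrite !inE ffunE /=.
  by have := c0 v; lia.
case/imfsetP => -[x r] /=; rewrite inE /= => /andP [/eqP xn xr] ->; split.
  have [q hq] := exists_firing_period (config_of (x, r)) hG ht.
  apply: (live_recurrent ht hq); first by case: hG.
  split=> [v|]; first by rewrite /chips ffunE.
  congr (absorbing _ _): xr; apply/setP => v; rewrite !inE /chips ffunE /=; lia.
transitivity (\sum_v (x v : nat))%N%:Z; last by rewrite xn.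
rewrite /nchips -natz natr_sum; apply: eq_bigr => v _.
by rewrite /chips ffunE natz.
Qed.

Lemma finite_recurrent_with n : finite_set (recurrent_with t n).
Proof. by rewrite recurrent_withE; apply: finite_fset. Qed.

Lemma nb_recurrentE n : nb_recurrent t n = #|live_configs G n|.
Proof.
rewrite /nb_recurrent recurrent_withE set_fsetK card_imfset //=.
by rewrite cardE.
Qed.

(** Absorbing sets are nonempty here, so only positive powers of [fps_pos] occur. Hence the
    generating series may start at 0 or at 1. *)
Lemma nb_recurrent0 : nb_recurrent t 0 = 0%N.
Proof.
rewrite nb_recurrentE; apply/eqP; rewrite -(@pnatr_eq0 int) card_live_configs big1 // => p.
case: hG => G0 _ /(absorbing_neq0 G0); rewrite -card_gt0 => /prednK <-.
by rewrite coef_fps_posX0.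
Qed.

Lemma fps_nb_recurrent :
  FPS (fun n : nat => if n == 0%N then 0 else (nb_recurrent t n)%:Z) =
  \det ((1 - fpsX)^-1 *: outdegree_mx G (fps int) - adjacency_mx G (fps int)).
Proof.
rewrite fps_inv_1subX -fps_1D_pos det_outdegree_adjacency.
apply: fpsP => n /=; rewrite coef_fps_sum -card_live_configs -nb_recurrentE.
by case: n => [|n] //=; rewrite ?nb_recurrent0 // natz.
Qed.

End CountRecurrent.

(** * Convergence in the unit disc *)

Section Convergence.

Lemma coef_fps_posX_bound (K : numFieldType) (a : K) k n : 0 < a < 1 ->
  0 <= coef_fps (fps_pos K ^+ k) n * a ^+ n <= (1 + a / (1 - a)) ^+ k.
Proof.
case/andP => a0 a1; have b0 : 0 < 1 - a by rewrite subr_gt0.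
have d0 : 0 <= a / (1 - a) by rewrite divr_ge0 // ltW.
elim: k n => [|k IH] n.
  rewrite !expr0 /=; case: n => [|n] /=; first by rewrite expr0 mulr1 ler01 lexx.
  by rewrite mul0r lexx ler01.
set d := a / (1 - a) in d0 IH *.
have dE : a * (d + 1) = d by rewrite /d; field; apply: lt0r_neq0.
(* The sharper bound [d * (1 + d) ^+ k] is stable under the recurrence in [n], because
   [a * (d + 1) = d]. *)
suff : 0 <= coef_fps (fps_pos K ^+ k.+1) n * a ^+ n <= d * (1 + d) ^+ k.
  case/andP => -> /le_trans; apply; rewrite exprS ler_wpM2r ?lerDr ?exprn_ge0 //.
  by rewrite addr_ge0.
elim: n => [|n /andP [l0 lu]].
  by rewrite coef_fps_posX0 mul0r lexx mulr_ge0 // exprn_ge0 // addr_ge0.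
rewrite coef_fps_posX_rec [a ^+ _]exprS mulrCA mulrDl -{1}dE -mulrA [(d + 1) * _]mulrDl mul1r.
have /andP [h0 hu] := IH n.
by rewrite mulr_ge0 ?addr_ge0 ?(ltW a0) //= ler_wpM2l ?(ltW a0) // lerD.
Qed.

(** Summing the recurrence expresses each partial sum for [k+1] as [z / (1 - z)] times the one for
    [k], up to a multiple of a single term that tends to 0. *)
Lemma series_fps_posX (K : numFieldType) (z : K) k : 1 - z != 0 ->
  (forall k, (fun n => coef_fps (fps_pos K ^+ k) n * z ^+ n) @ \oo --> (0 : K^o)) ->
  (fun N => \sum_(0 <= n < N) coef_fps (fps_pos K ^+ k) n * z ^+ n) @ \oo
    --> ((z / (1 - z)) ^+ k : K^o).
Proof.
move=> z1 null; elim: k => [|k IH].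
  apply: cvg_near_cst; exists 1%N => // -[//|N] _.
  rewrite big_nat_recl //= expr0 mulr1 big1 ?addr0 // => n _.
  by rewrite mul0r.
have -> : (fun N => \sum_(0 <= n < N) coef_fps (fps_pos K ^+ k.+1) n * z ^+ n) =
    (fun N => (z * (\sum_(0 <= n < N) coef_fps (fps_pos K ^+ k) n * z ^+ n)
      - coef_fps (fps_pos K ^+ k.+1) N * z ^+ N) / (1 - z)).
  apply: funext => N; apply: (mulIf z1); rewrite divfK //.
  elim: N => [|N IHN]; first by rewrite !big_geq // coef_fps_posX0; ring.
  rewrite !big_nat_recr //= mulrDl IHN coef_fps_posX_rec [z ^+ N.+1]exprS.
  by ring.
rewrite [(z / _) ^+ _]exprS mulrAC -[z * _ ^+ _]subr0.
by apply: cvgMr_tmp; apply: (@cvgB _ K^o); [apply: cvgMl_tmp|apply: null].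
Qed.

Variable R : realType.

Lemma normc_lt1 (z : R[i]) : `|z| < 1 -> exists2 r : R, 0 <= r < 1 & `|z| = (r%:C)%C.
Proof.
case: z => a b; rewrite normc_def => h; exists (Num.sqrt (a ^+ 2 + b ^+ 2)) => //.
by rewrite sqrtr_ge0 /=; move: h; rewrite (ltcR _ 1).
Qed.

Lemma null_coef_fps_posX (z : R[i]) k : `|z| < 1 ->
  (fun n => coef_fps (fps_pos R[i] ^+ k) n * z ^+ n) @ \oo --> (0 : R[i]^o).
Proof.
move=> /normc_lt1 [r /andP [r0 r1] zr].
(* Any [a] strictly between [r] and 1 works: the bound at [a] dominates the terms by
   [D * (r / a) ^+ n]. The midpoint is positive even if [r] is 0. *)
pose a := (1 + r) / 2.
have a0 : 0 < a by rewrite /a; lra.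
have a1 : a < 1 by rewrite /a; lra.
pose D := (1 + a / (1 - a)) ^+ k.
have D0 : 0 < D by rewrite exprn_gt0 // addr_gt0 // divr_gt0 // subr_gt0.
have q0 : 0 <= r / a by rewrite divr_ge0 // ltW.
have q1 : `|r / a| < 1 by rewrite ger0_norm // ltr_pdivrMr // mul1r /a; lra.
(* A positive complex number has imaginary part 0, so the tolerance is a real [e]. *)
apply/(@cvgrPdist_lt _ R[i]^o) => -[e e']; rewrite ltcE /= => /andP [/eqP -> e0].
have /cvgrPdist_lt /(_ (e / D)) := cvg_expr q1.
rewrite divr_gt0 // => /(_ isT); apply: filterS => n.
rewrite !sub0r !normrN ger0_norm ?exprn_ge0 // ltr_pdivlMr // => en.
pose aC : R[i] := (a%:C)%C.
have a01 : 0 < aC < 1 by rewrite /aC (ltcR 0) (ltcR _ 1) a0.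
have /andP [c0 cD] := coef_fps_posX_bound k n a01.
have DE : (1 + aC / (1 - aC)) ^+ k = (D%:C)%C.
  by rewrite /D rmorphXn rmorphD rmorph1 fmorph_div rmorphB rmorph1.
apply: le_lt_trans (_ : (((r / a) ^+ n * D)%:C)%C < _); last by rewrite ltcR.
have aCn : 0 < aC ^+ n by rewrite exprn_gt0 //; case/andP: a01.
move: c0; rewrite pmulr_lge0 // => c0; rewrite normrM normrX zr ger0_norm //.
rewrite rmorphM /= -DE rmorphXn fmorph_div /= -/aC expr_div_n mulrAC ler_pdivlMr //.
rewrite mulrAC.
by rewrite [leRHS]mulrC ler_wpM2r // exprn_ge0 // (lecR 0).
Qed.

Lemma cvg_nb_recurrent (G : digraph) (t : vertex G -> {perm edge G}) (z : R[i]) :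
  strongly_connected G -> rotor_mechanism t -> `|z| < 1 ->
  (fun N : nat => \sum_(1 <= n < N) (nb_recurrent t n)%:R * z ^+ n) @ \oo
    --> (\det ((1 - z)^-1 *: outdegree_mx G R[i] - adjacency_mx G R[i]) : R[i]^o).
Proof.
move=> hG ht z1.
have z1' : 1 - z != 0 by rewrite subr_eq0; apply: contraTneq z1 => <-; rewrite normr1 ltxx.
have -> : (1 - z)^-1 = 1 + z / (1 - z) by field.
rewrite det_outdegree_adjacency.
have -> : (fun N : nat => \sum_(1 <= n < N) (nb_recurrent t n)%:R * z ^+ n) =
    (fun N => \sum_(p : rotor_config G * {set vertex G} | absorbing (rotor_target p.1) p.2)
       \sum_(0 <= n < N) coef_fps (fps_pos R[i] ^+ #|p.2|) n * z ^+ n).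
  apply: funext => N; rewrite exchange_big /=.
  transitivity (\sum_(0 <= n < N) (nb_recurrent t n)%:R * z ^+ n).
    case: N => [|N]; first by rewrite !big_geq.
    by rewrite [RHS]big_ltn // nb_recurrent0 // mul0r add0r.
  by apply: eq_bigr => n _; rewrite nb_recurrentE // card_live_configs mulr_suml.
have lim (p : rotor_config G * {set vertex G}) : absorbing (rotor_target p.1) p.2 ->
    (fun N => \sum_(0 <= n < N) coef_fps (fps_pos R[i] ^+ #|p.2|) n * z ^+ n) @ \oo
      --> ((z / (1 - z)) ^+ #|p.2| : R[i]^o).
  by move=> _; apply: series_fps_posX => // k; apply: null_coef_fps_posX.
exact: (@cvg_big R[i]^o _ +%R 0 _ (@add_continuous R[i]^o) nat \oo (index_enum _) _ _ _ lim).
Qed.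

End Convergence.

Local Open Scope complex_scope.

Theorem theorem1p4 (R : realType) (G : digraph)
    (t : vertex G -> {perm edge G})
    (hG : strongly_connected G) (ht : rotor_mechanism t) :
  [/\ forall n : nat, (1 <= n)%N -> finite_set (recurrent_with t n),
      forall z : R[i], `|z| < 1 ->
        (fun N : nat => \sum_(1 <= n < N) (nb_recurrent t n)%:R * z ^+ n) @ \oo
          --> (\det ((1 - z)^-1 *: outdegree_mx G R[i] - adjacency_mx G R[i])
               : R[i]^o) &
      FPS (fun n : nat => if n == 0%N then 0 else (nb_recurrent t n)%:Z) =
        \det ((1 - fpsX)^-1 *: outdegree_mx G (fps int)
              - adjacency_mx G (fps int))].
Proof.
split=> [n _|z|]; first exact: finite_recurrent_with.
  exact: cvg_nb_recurrent.
exact: fps_nb_recurrent.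
Qed.
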